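(* Let $R$ be an arbitrary (not necessarily unital) ring with stable rank one and let $P, Q \in \mathcal{CP}(R)$. Then: (i) $P \prec Q$ if and only if $P$ is isomorphic to a pure submodule $P'$ of $Q$ such that $P'$ is contained in a finitely generated submodule of $Q$. (ii) $[P] \leq [Q]$ in $\mathrm{CP}(R)$ if and only if $P$ is isomorphic to a pure submodule of $Q$. (iii) $[P] = [Q]$ in $\mathrm{CP}(R)$ if and only if $P \cong Q$.
   Context: Rings are associative, not necessarily unital unless stated. For an arbitrary ring $R$, $R^+ = \mathbb{Z}\oplus R$ denotes the Dorroh unitization, in which $R$ is a two-sided ideal. The ring $R$ has stable rank one if for all $a,b,x\in R^+$ with $a-1\in R$ and $xa+b=1$ there is $y\in R^+$ (equivalently $y \in R$) such that $a+yb$ is invertible in $R^+$. For unital $R$ this is equivalent to: for all $a,b\in R$ with $Ra+Rb=R$ there is $y\in R$ with $R(a+yb)=R$. $\mathcal{CP}(R)$ denotes the class of all countably generated unital projective right $R^+$-modules $P$ with $P=PR$. (For unital $R$ these are just the countably generated projective unital right $R$-modules.) Homomorphisms and submodules are those of right $R^+$-modules. For $P,Q\in\mathcal{CP}(R)$: - $P\precsim Q$ means: for every finitely generated submodule $X$ of $P$ there are module homomorphisms $\phi\colon X\to Q$ and $\psi\colon Q\to P$ such that $\psi\circ\phi$ is the inclusion $X\hookrightarrow P$. - $P\prec Q$ means: there is a finitely generated submodule $Y$ of $Q$ such that for every finitely generated submodule $X$ of $P$ there are module homomorphisms $\phi\colon X\to Q$ and $\psi\colon Q\to P$ such that $\psi\circ\phi$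 is the inclusion $X\hookrightarrow P$ and $\phi(X)\subseteq Y$. - $P\sim Q$ means $P\precsim Q$ and $Q\precsim P$. $\mathrm{CP}(R)=\mathcal{CP}(R)/{\sim}$, $[P]$ is the class of $P$, and $[P]\le[Q]$ means $P\precsim Q$. A submodule $N$ of a right module $M$ over a unital ring $S$ (here $S=R^+$) is pure if for every left $S$-module $X$ the map $N\otimes_S X\to M\otimes_S X$ induced by inclusion is injective. (When $M$ is projective this is equivalent to: for every finitely generated submodule $F\subseteq N$ there is a homomorphism $\sigma\colon M\to N$ with $\sigma|_F=\mathrm{id}_F$.) *)

(* Defs.v *)
From HB Require Import structures.
From mathcomp Require Import all_boot all_algebra.
From mathcomp Require Import boolp.

Set Implicit Arguments.
Unset Strict Implicit.
Unset Printing Implicit Defensive.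

Import GRing.Theory.
Local Open Scope ring_scope.

(* Associative rings, not necessarily unital (and possibly zero). *)
HB.mixin Record Zmodule_isRng R of GRing.Zmodule R := {
  rmul : R -> R -> R;
  rmulA : associative rmul;
  rmulDl : left_distributive rmul +%R;
  rmulDr : right_distributive rmul +%R
}.

#[short(type="rngType")]
HB.structure Definition Rng := {R of Zmodule_isRng R & GRing.Zmodule R}.

Section RngTheory.
Variable R : rngType.
Implicit Types x y z : R.

Lemma rmul0r x : rmul 0 x = 0.
Proof. by apply: (addrI (rmul 0 x)); rewrite -rmulDl !addr0. Qed.

Lemma rmulr0 x : rmul x 0 = 0.
Proof. by apply: (addrI (rmul x 0)); rewrite -rmulDr !addr0. Qed.

Lemma rmulNr x y : rmul (- x) y = - rmul x y.
Proof. by apply/eqP; rewrite -addr_eq0 -rmulDl addNr rmul0r. Qed.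

Lemma rmulrN x y : rmul x (- y) = - rmul x y.
Proof. by apply/eqP; rewrite -addr_eq0 -rmulDr addNr rmulr0. Qed.

Lemma rmulMzl x y (n : int) : rmul (x *~ n) y = rmul x y *~ n.
Proof.
have E k : rmul (x *+ k) y = rmul x y *+ k.
  by elim: k => [|k IHk]; rewrite ?mulr0n ?rmul0r // !mulrS rmulDl IHk.
by case: n => n; rewrite ?NegzE ?mulrNz -?pmulrn ?rmulNr E.
Qed.

Lemma rmulMzr x y (n : int) : rmul x (y *~ n) = rmul x y *~ n.
Proof.
have E k : rmul x (y *+ k) = rmul x y *+ k.
  by elim: k => [|k IHk]; rewrite ?mulr0n ?rmulr0 // !mulrS rmulDr IHk.
by case: n => n; rewrite ?NegzE ?mulrNz -?pmulrn ?rmulrN E.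
Qed.

End RngTheory.

(* The Dorroh unitization R^+ = Z (+) R; the alias keeps [int * R] free of *)
(* the componentwise product.                                              *)
Definition dorroh (R : rngType) : Type := (int * R)%type.

Section Dorroh.
Variable R : rngType.

HB.instance Definition _ := GRing.Zmodule.copy (dorroh R) (int * R)%type.

Definition dorroh_one : dorroh R := (1, 0).
Definition dorroh_mul (a b : dorroh R) : dorroh R :=
  (a.1 * b.1, b.2 *~ a.1 + a.2 *~ b.1 + rmul a.2 b.2).

Lemma dorroh_mulA : associative dorroh_mul.
Proof.
move=> [m r] [n s] [p t]; rewrite /dorroh_mul /= mulrA; congr pair.
rewrite !mulrzDl !rmulDl !rmulDr !rmulMzl !rmulMzr rmulA -!mulrzA.
rewrite [(n * m)%R]mulrC [(p * m)%R]mulrC -!addrA; do 2!congr (_ + _).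
by rewrite addrCA; congr (_ + _); rewrite (addrCA (rmul r t *~ n)) addrCA.
Qed.

Lemma dorroh_mul1 : left_id dorroh_one dorroh_mul.
Proof.
by move=> [n s]; rewrite /dorroh_mul /= mul1r mulr1z mul0rz rmul0r !addr0.
Qed.

Lemma dorroh_mulr1 : right_id dorroh_one dorroh_mul.
Proof.
by move=> [n s]; rewrite /dorroh_mul /= mulr1 mulr1z mul0rz rmulr0 add0r addr0.
Qed.

Lemma dorroh_mulDl : left_distributive dorroh_mul +%R.
Proof.
move=> [m r] [n s] [p t]; apply: injective_projections => /=; first exact: mulrDl.
by rewrite mulrzDr mulrzDl rmulDl (addrACA (t *~ m)) [LHS]addrACA.
Qed.

Lemma dorroh_mulDr : right_distributive dorroh_mul +%R.
Proof.
move=> [m r] [n s] [p t]; apply: injective_projections => /=; first exact: mulrDr.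
by rewrite mulrzDl mulrzDr rmulDr (addrACA (s *~ m)) [LHS]addrACA.
Qed.

Lemma dorroh_1neq0 : dorroh_one != 0.
Proof. by []. Qed.

HB.instance Definition _ := GRing.Zmodule_isNzRing.Build (dorroh R)
  dorroh_mulA dorroh_mul1 dorroh_mulr1 dorroh_mulDl dorroh_mulDr dorroh_1neq0.

(* The copy of R inside R^+. *)
Definition dorroh_in (r : R) : dorroh R := (0, r).

Lemma dorroh_inM r s : dorroh_in (rmul r s) = dorroh_in r * dorroh_in s.
Proof. by congr pair; rewrite /= !mulr0z !add0r. Qed.

End Dorroh.

Definition invertible (S : pzRingType) (a : S) : Prop :=
  exists u : S, a * u = 1 /\ u * a = 1.

Definition stable_rank_one (R : rngType) : Prop :=
  forall a b x : dorroh R,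
    (exists r : R, a - 1 = dorroh_in r) -> x * a + b = 1 ->
    exists y : dorroh R, invertible (a + y * b).

(* A right S-module is a left module over the converse ring: for x in M and  *)
(* a in S, x.a is written [(a : S^c) *: x].                                  *)
Notation rmodType S := (lmodType S^c).

Section Submodules.
Variables (S : pzRingType) (M : lmodType S) (N : submodClosed M).

Record submod := Submod { submod_val : M; submod_valP : submod_val \in N }.

HB.instance Definition _ := [isSub for submod_val].
HB.instance Definition _ := [Choice of submod by <:].
HB.instance Definition _ := [SubChoice_isSubLmodule of submod by <:].

Definition submod_incl : {linear submod -> M} := \val.

End Submodules.

Definition isomorphic (S : pzRingType) (M N : lmodType S) : Prop :=
  exists f : {linear M -> N}, bijective f.

Definition finitely_generated (S : pzRingType) (M : lmodType S) : Prop :=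
  exists (n : nat) (g : 'I_n -> M),
    forall x : M, exists c : 'I_n -> S, x = \sum_(i < n) c i *: g i.

Definition countably_generated (S : pzRingType) (M : lmodType S) : Prop :=
  exists g : nat -> M,
    forall x : M, exists (n : nat) (c : 'I_n -> S),
      x = \sum_(i < n) c i *: g i.

Definition projective (S : pzRingType) (P : lmodType S) : Prop :=
  forall (M N : lmodType S) (g : {linear M -> N}) (f : {linear P -> N}),
    (forall y : N, exists x : M, g x = y) ->
    exists h : {linear P -> M}, forall x : P, g (h x) = f x.

Section Tensor.
Variables (S : pzRingType) (M : rmodType S) (X : lmodType S).

(* The sequence [:: (m1, x1); ..; (mk, xk)] stands for the formal sum of the *)
(* mi (x) xi. Signs are not needed: modulo [tensor_eq], (- m) (x) x is the   *)
(* opposite of m (x) x.                                                      *)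
Inductive tensor_eq : seq (M * X) -> seq (M * X) -> Prop :=
| tensor_eq_refl s : tensor_eq s s
| tensor_eq_sym s t : tensor_eq s t -> tensor_eq t s
| tensor_eq_trans s t u : tensor_eq s t -> tensor_eq t u -> tensor_eq s u
| tensor_eq_cat s s' t t' :
    tensor_eq s s' -> tensor_eq t t' -> tensor_eq (s ++ t) (s' ++ t')
| tensor_eq_catC s t : tensor_eq (s ++ t) (t ++ s)
| tensor_eq_0 x : tensor_eq [:: (0, x)] [::]
| tensor_eq_Dl m m' x : tensor_eq [:: (m + m', x)] [:: (m, x); (m', x)]
| tensor_eq_Dr m x x' : tensor_eq [:: (m, x + x')] [:: (m, x); (m, x')]
| tensor_eq_Z (a : S) m x :
    tensor_eq [:: ((a : S^c) *: m, x)] [:: (m, a *: x)].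

Definition tensor_eqb (s t : seq (M * X)) : bool := `[< tensor_eq s t >].

Lemma tensor_eqb_equiv : equiv_class_of tensor_eqb.
Proof.
split=> [s|s t|t s u].
- exact/asboolP/tensor_eq_refl.
- by apply/asboolP/asboolP; exact: tensor_eq_sym.
- by move=> /asboolP st /asboolP tu; apply/asboolP/(tensor_eq_trans st tu).
Qed.

Canonical tensor_eqb_rel := EquivRelPack tensor_eqb_equiv.

(* M (x)_S X *)
Definition tensor : Type := {eq_quot tensor_eqb}%qT.

Definition tensor_pi (s : seq (M * X)) : tensor :=
  (\pi_{eq_quot tensor_eqb} s)%qT.

Definition tensor_repr (t : tensor) : seq (M * X) :=
  repr (t : {eq_quot tensor_eqb}%qT).

Lemma tensor_piP s t : tensor_pi s = tensor_pi t <-> tensor_eq s t.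
Proof.
by split=> [/eqP|st]; [rewrite /tensor_pi eqmodE => /asboolP |
  apply/eqP; rewrite /tensor_pi eqmodE; apply/asboolP].
Qed.

Lemma tensor_reprK t : tensor_pi (tensor_repr t) = t.
Proof. exact: reprK. Qed.

End Tensor.

Section TensorMap.
Variables (S : pzRingType) (M N : rmodType S) (X : lmodType S).
Variable f : {linear M -> N}.

(* f (x) id : M (x)_S X -> N (x)_S X *)
Definition tensor_map (t : tensor M X) : tensor N X :=
  tensor_pi [seq (f z.1, z.2) | z <- tensor_repr t].

Lemma tensor_eq_map (s t : seq (M * X)) : tensor_eq s t ->
  tensor_eq [seq (f z.1, z.2) | z <- s] [seq (f z.1, z.2) | z <- t].
Proof.
elim=> {s t} [s|s t _|s t u _ + _|s s' t t' _ + _|s t|x|m m' x|m x x'|a m x] /=.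
- exact: tensor_eq_refl.
- exact: tensor_eq_sym.
- exact: tensor_eq_trans.
- by rewrite !map_cat; exact: tensor_eq_cat.
- by rewrite !map_cat; exact: tensor_eq_catC.
- by rewrite linear0; exact: tensor_eq_0.
- by rewrite linearD; exact: tensor_eq_Dl.
- exact: tensor_eq_Dr.
- by rewrite linearZ; exact: tensor_eq_Z.
Qed.

Lemma tensor_mapE s :
  tensor_map (tensor_pi s) = tensor_pi [seq (f z.1, z.2) | z <- s].
Proof. exact/tensor_piP/tensor_eq_map/tensor_piP/tensor_reprK. Qed.

End TensorMap.

Definition pure (S : pzRingType) (M : rmodType S) (N : submodClosed M) : Prop :=
  forall X : lmodType S, injective (@tensor_map S _ _ X (submod_incl N)).

Section Comparison.
Variable S : pzRingType.

Definition precsim (P Q : lmodType S) : Prop :=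
  forall X : submodClosed P, finitely_generated (submod X) ->
    exists (phi : {linear submod X -> Q}) (psi : {linear Q -> P}),
      forall x : submod X, psi (phi x) = submod_incl X x.

Definition prec (P Q : lmodType S) : Prop :=
  exists Y : submodClosed Q, finitely_generated (submod Y) /\
    forall X : submodClosed P, finitely_generated (submod X) ->
      exists (phi : {linear submod X -> Q}) (psi : {linear Q -> P}),
        (forall x : submod X, psi (phi x) = submod_incl X x) /\
        (forall x : submod X, phi x \in Y).

Lemma precsim_refl (P : lmodType S) : precsim P P.
Proof. by move=> X _; exists (submod_incl X), idfun. Qed.

Section Image.
Variables (M N : lmodType S) (f : {linear M -> N}).

Definition im_pred : {pred N} := fun y => `[< exists x, f x = y >].

Lemma im_submod_closed : submod_closed im_pred.
Proof.
split=> [|a _ _ /asboolP[x <-] /asboolP[y <-]]; apply/asboolP.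
- by exists 0; rewrite linear0.
- by exists (a *: x + y); rewrite linearP.
Qed.

HB.instance Definition _ := GRing.isSubmodClosed.Build S N im_pred im_submod_closed.

Lemma mem_im x : f x \in im_pred. Proof. by apply/asboolP; exists x. Qed.

Definition corestr (x : M) : submod im_pred := Submod (mem_im x).

Lemma corestr_linear : linear corestr.
Proof. by move=> a x y; apply: val_inj; rewrite /= !linearP. Qed.

HB.instance Definition _ := GRing.isLinear.Build S M (submod im_pred) *:%R corestr
  corestr_linear.

Lemma fg_im : finitely_generated M -> finitely_generated (submod im_pred).
Proof.
move=> [n [g gP]]; exists n, (corestr \o g) => -[y yP].
have /asboolP[x fx] := yP; have [c xE] := gP x; exists c; apply: val_inj.
rewrite [RHS](linear_sum (submod_incl _)) -[LHS]fx xE linear_sum.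
by apply: eq_bigr => i _; rewrite [RHS]linearZ linearZ.
Qed.

End Image.

Lemma precsim_trans (P Q T : lmodType S) :
  precsim P Q -> precsim Q T -> precsim P T.
Proof.
move=> PQ QT X fgX; have [phi [psi E]] := PQ X fgX.
have [phi' [psi' E']] := QT _ (fg_im phi fgX).
exists (phi' \o corestr phi), (psi \o psi') => x /=.
by rewrite E' /= E.
Qed.

End Comparison.

(* P = PR, where P is a right R^+-module. *)
Definition eq_PR (R : rngType) (P : rmodType (dorroh R)) : Prop :=
  forall x : P, exists (n : nat) (q : 'I_n -> P) (r : 'I_n -> R),
    x = \sum_(i < n) (dorroh_in (r i) : (dorroh R)^c) *: q i.

Record cpModule (R : rngType) := CPModule {
  cp_sort :> rmodType (dorroh R);
  cp_countable : countably_generated cp_sort;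
  cp_projective : projective cp_sort;
  cp_eq_PR : eq_PR cp_sort
}.

Section CP.
Variable R : rngType.
Implicit Types P Q : cpModule R.

Definition cp_sim P Q : Prop := precsim P Q /\ precsim Q P.

Definition CP : Type :=
  {A : cpModule R -> Prop | exists P, A = (fun Q => cp_sim Q P)}.

Definition cp_class P : CP :=
  exist _ (fun Q => cp_sim Q P) (ex_intro _ P erefl).

Definition cp_le (A B : CP) : Prop :=
  exists P Q, [/\ A = cp_class P, B = cp_class Q & precsim P Q].

Lemma cp_classP P Q : cp_class P = cp_class Q <-> cp_sim P Q.
Proof.
split=> [[E]|[PQ QP]].
  by have /= <- := congr1 (@^~ P) E; split; exact: precsim_refl.
apply: eq_exist; apply/funext => T; apply/propext; split=> -[TA AT].
  by split; [exact: precsim_trans TA PQ | exact: precsim_trans QP AT].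
by split; [exact: precsim_trans TA QP | exact: precsim_trans PQ AT].
Qed.

Lemma cp_leP P Q : cp_le (cp_class P) (cp_class Q) <-> precsim P Q.
Proof.
split=> [[P' [Q' [/cp_classP[PP' _] /cp_classP[_ Q'Q] P'Q']]]|PQ].
  exact: precsim_trans PP' (precsim_trans P'Q' Q'Q).
by exists P, Q.
Qed.

End CP.

(* Main.v *)
Require Import Defs.
From HB Require Import structures.
From mathcomp Require Import all_boot all_algebra.
From mathcomp Require Import boolp.

(** Why the theorem is true. Write S = R^+ and let Q be a projective module with
    Q = QR. Every linear functional on Q takes its values in R, so a
    finite-rank endomorphism of Q is governed by a matrix over R, and stable
    rank one of R, inherited by the matrix rings over R
    ([ideal_sr1_matrix]), gives a substitution property for endomorphisms of
    Q of the form 1 + (finite rank) ([correct_endomorphism]).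

    Its consequence is the lemma that carries the proof, [align_splittings]:
    if f and g are two maps P -> Q of finite rank that both have left inverses
    on a finite set s, then some automorphism u of Q satisfies u g = f on s.
    So an embedding of a small part of P may be replaced by an embedding of a
    larger part without changing what was already built.

    The relation P <~ Q says that every finite part of P embeds into Q with a left
    inverse, and since P has a dual basis both maps may be taken on all of P
    and Q ([precsim_approximable]). Aligning a sequence of such maps f_n along
    generators of P makes it eventually constant at each element; the limit
    P -> Q is split on every finite set ([approximable_embedding]). For the
    relation P < Q all the f_n have their values in one finitely generated
    submodule, every aligning automorphism is the identity modulo a second
    one, and the limit stays inside it ([approximable_fg_embedding]). When
    both P <~ Q and Q <~ P hold, aligning alternately in Q and in P gives a
    back-and-forth construction of an isomorphism
    ([approximable_isomorphic]).

    Finally, maps split on finite sets are the same as pure embeddings when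
    the target has a dual basis. One direction is functoriality of the tensor
    product ([locally_split_pure]); for the other, purity is tested on the
    left module presented by the linear relations between finitely many
    elements of the submodule ([pure_retraction]). *)

Set Implicit Arguments.
Unset Strict Implicit.
Unset Printing Implicit Defensive.

Import GRing.Theory.
Local Open Scope ring_scope.

(** * Stable rank one relative to an ideal, and matrices *)

Definition two_sided_ideal (T : pzRingType) (J : T -> Prop) : Prop :=
  [/\ J 0, forall x y, J x -> J y -> J (x + y),
      forall a x, J x -> J (a * x) & forall a x, J x -> J (x * a)].

(** The condition is imposed on the side opposite to the one of
    [stable_rank_one]: T will be the converse of the Dorroh ring, over which
    right R^+-modules are left modules. *)
Definition ideal_sr1 (T : pzRingType) (J : T -> Prop) : Prop :=
  forall a x b : T, J (a - 1) -> a * x + b = 1 ->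
    exists y, invertible (a + b * y).

Definition entrywise (T : pzRingType) (J : T -> Prop) m n (A : 'M[T]_(m, n)) :=
  forall i j, J (A i j).

Section Invertible.
Variable K : pzRingType.
Implicit Types a b c d l e x y : K.

Lemma invertibleM a b : invertible a -> invertible b -> invertible (a * b).
Proof.
move=> [a' [aa' a'a]] [b' [bb' b'b]]; exists (b' * a').
by rewrite -!mulrA (mulrA b) bb' mul1r aa' (mulrA a') a'a mul1r b'b.
Qed.

(** Row and column operations on a, as well as adding multiples of b to a, do
    not affect whether a can be corrected to a unit by a multiple of b: the
    equation a x + b = 1 turns into one for the new a, whose second summand is
    still a multiple of b up to units. *)
Lemma correctable_reduction a b x l l' e e' y1 a1 :
    l * l' = 1 -> l' * l = 1 -> e * e' = 1 -> e' * e = 1 ->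
    a * x + b = 1 -> a1 = l * (a + b * y1) * e ->
    (forall x1 b1, a1 * x1 + b1 = 1 -> exists y, invertible (a1 + b1 * y)) ->
  exists y, invertible (a + b * y).
Proof.
move=> ll' l'l ee' e'e axb Da1 corr.
have E : (a + b * y1) * x + b * (1 - y1 * x) = 1.
  by rewrite mulrDl mulrBr mulr1 mulrA (addrC b) addrA addrK.
have [|y uy] := corr (e' * x * l') (l * (b * (1 - y1 * x)) * l').
  have -> : a1 * (e' * x * l') = l * ((a + b * y1) * x) * l'.
    by rewrite Da1 !mulrA -(mulrA _ e e') ee' mulr1.
  by rewrite -mulrDl -mulrDr E mulr1.
exists (y1 + (1 - y1 * x) * (l' * y * e')).
have -> : a + b * (y1 + (1 - y1 * x) * (l' * y * e')) =
          l' * (a1 + l * (b * (1 - y1 * x)) * l' * y) * e'.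
  rewrite (mulrDr l') mulrDl mulrDr addrA; congr (_ + _).
    by rewrite Da1 !mulrA l'l mul1r -(mulrA _ e e') ee' mulr1.
  by rewrite !mulrA l'l mul1r.
apply: invertibleM; last by exists e.
by apply: invertibleM => //; exists l.
Qed.

End Invertible.

Section MatrixStableRank.
Variables (T : pzRingType) (J : T -> Prop).
Hypothesis JI : two_sided_ideal J.

Lemma entrywiseD m n (A B : 'M[T]_(m, n)) :
  entrywise J A -> entrywise J B -> entrywise J (A + B).
Proof. by case: JI => _ JD _ _ JA JB i j; rewrite mxE; apply: JD. Qed.

Lemma entrywise_sum n (F : 'I_n -> T) : (forall i, J (F i)) -> J (\sum_i F i).
Proof. by case: JI => J0 JD _ _ JF; apply: big_ind. Qed.

Lemma entrywiseMl m n p (A : 'M[T]_(m, n)) (B : 'M[T]_(n, p)) :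
  entrywise J B -> entrywise J (A *m B).
Proof.
by case: JI => _ _ JM _ JB i j; rewrite mxE; apply: entrywise_sum => k; apply: JM.
Qed.

Lemma invertible_trig_block m n (u : 'M[T]_m) (s : 'M[T]_(m, n)) (v : 'M[T]_n) :
  invertible u -> invertible v -> invertible (block_mx u s 0 v).
Proof.
move=> [u' [uu' u'u]] [v' [vv' v'v]].
exists (block_mx u' (- (u' *m s *m v')) 0 v'); rewrite -[1]/(1%:M) scalar_mx_block.
split; rewrite [LHS]mulmx_block !mulmx0 !mul0mx !addr0 !add0r; congr block_mx.
- exact: uu'.
- by rewrite mulmxN !mulmxA [u *m u']uu' mul1mx addNr.
- exact: vv'.
- exact: u'u.
- by rewrite mulNmx -mulmxA [v' *m v]v'v mulmx1 addrN.
- exact: v'v.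
Qed.

(** Gaussian elimination. Correcting the upper left block of A by the
    hypothesis in size m makes that block a unit u, which clears the block
    below it. The Schur complement d of u still differs from the identity by
    a matrix over J, because it is changed only by multiples of the upper
    right block; the hypothesis in size n corrects it. *)
Lemma ideal_sr1_block m n :
    ideal_sr1 (@entrywise T J m m) -> ideal_sr1 (@entrywise T J n n) ->
  ideal_sr1 (@entrywise T J (m + n) (m + n)).
Proof.
move=> sr_m sr_n A X B JA AXB.
pose a11 := ulsubmx A; pose a12 := ursubmx A; pose a21 := dlsubmx A.
pose a22 := drsubmx A; pose x11 := ulsubmx X; pose x21 := dlsubmx X.
have DA : A = block_mx a11 a12 a21 a22 by rewrite submxK.
have one_block : (1 : 'M[T]_(m + n)) = block_mx 1%:M 0 0 1%:M.
  by rewrite -scalar_mx_block.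
have Ja11 : entrywise J (a11 - 1).
  by move=> i j; have:= JA (lshift n i) (lshift n j); rewrite !mxE eq_lshift.
have Ja22 : entrywise J (a22 - 1).
  by move=> i j; have:= JA (rshift m i) (rshift m j); rewrite !mxE eq_rshift.
have Ja12 : entrywise J a12.
  move=> i j; have:= JA (lshift n i) (rshift m j).
  by rewrite !mxE eq_lrshift subr0.
have DX : X = block_mx x11 (ursubmx X) x21 (drsubmx X) by rewrite submxK.
pose b11 := ulsubmx B; pose b21 := dlsubmx B.
have DB : B = block_mx b11 (ursubmx B) b21 (drsubmx B) by rewrite submxK.
have /(sr_m a11)[//|y [u' [uu' u'u]]] : a11 * x11 + (a12 *m x21 + b11) = 1.
  have := AXB; rewrite -[A * X]/(A *m X) {1}DA {1}DX {1}DB mulmx_block.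
  rewrite add_block_mx one_block => /eq_block_mx[E _ _ _].
  by rewrite addrA; exact: E.
set u := a11 + _ in uu' u'u.
pose low (z : 'M[T]_(n, m)) : 'M[T]_(m + n) := block_mx 1%:M 0 z 1%:M.
have lowV z : low z * low (- z) = 1.
  rewrite one_block [LHS]mulmx_block !mul1mx !mul0mx mulmx0 !mulmx1.
  by rewrite !addr0 add0r addrN.
have lowV' z : low (- z) * low z = 1 by rewrite -{2}(opprK z) lowV.
pose c := a21 + a22 *m (x21 *m y) + b21 *m y.
pose d := a22 - c *m u' *m a12.
(* Right multiplication by [low (x21 *m y)] adds to a11 the part of its
   correction that comes from a12; [block_mx y 0 0 0] adds the part from B. *)
apply: (@correctable_reduction _ A B X (low (- (c *m u'))) (low (c *m u'))
  (low (x21 *m y)) (low (- (x21 *m y))) (block_mx y 0 0 0) (block_mx u a12 0 d))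
  => //.
  rewrite -mulrA; have -> : (A + B * block_mx y 0 0 0) * low (x21 *m y) =
                  block_mx u a12 c a22.
    rewrite {1}DA {1}DB [_ * block_mx y _ _ _]mulmx_block !mulmx0 !addr0.
    rewrite add_block_mx !addr0 [LHS]mulmx_block !mulmx1 !mulmx0 !add0r.
    congr block_mx; last by rewrite /c addrAC.
    by rewrite /u [_ * y]mulmxDl mulmxA -addrA (addrC (b11 *m y)).
  rewrite [RHS]mulmx_block !mul1mx !mul0mx !addr0 !mulNmx -mulmxA.
  by rewrite [u' *m u]u'u mulmx1 addNr /d addrC.
move=> X1 B1 E.
have /(sr_n d)[|y2 inv_d] : d * drsubmx X1 + drsubmx B1 = 1.
- have := E; rewrite -[_ * X1]/(_ *m X1) -{1}[X1]submxK -{1}[B1]submxK mulmx_block.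
  by rewrite add_block_mx one_block !mul0mx !add0r => /eq_block_mx[_ _ _ ->].
- rewrite /d addrAC -mulNmx; apply: entrywiseD => //; exact: entrywiseMl.
exists (block_mx 0 0 0 y2).
have -> : block_mx u a12 0 d + B1 * block_mx 0 0 0 y2 =
    block_mx u (a12 + ursubmx B1 *m y2) 0 (d + drsubmx B1 * y2).
  rewrite -{1}[B1]submxK [_ * block_mx _ _ _ y2]mulmx_block !mulmx0 !add0r.
  by rewrite add_block_mx !addr0.
by apply: invertible_trig_block => //; exists u'.
Qed.

Lemma ideal_sr1_matrix n : ideal_sr1 J -> ideal_sr1 (@entrywise T J n n).
Proof.
move=> sr; elim: n => [|n IHn].
  move=> A X B _ _; exists 0, 1; by split; apply/matrixP => -[].
apply: (@ideal_sr1_block 1 n) => // A X B JA E.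
have [||y [y' [yy' y'y]]] := sr (A 0 0) (X 0 0) (B 0 0).
- by have := JA 0 0; rewrite !mxE.
- by have /matrixP/(_ 0 0) := E; rewrite !mxE big_ord1.
exists y%:M, y'%:M; rewrite (mx11_scalar A) (mx11_scalar B).
have M (s t : T) : s%:M * t%:M = (s * t)%:M :> 'M_1.
  by apply: esym; apply: scalar_mxM.
by rewrite M -raddfD /= !M yy' y'y.
Qed.

End MatrixStableRank.

(** * Correcting finite-rank perturbations of the identity *)

Definition ideal_full (T : pzRingType) (J : T -> Prop) (Q : lmodType T) : Prop :=
  forall z : Q, exists (n : nat) (q : 'I_n -> Q) (r : 'I_n -> T),
    (forall i, J (r i)) /\ z = \sum_(i < n) r i *: q i.

(** A local form of the dual basis lemma: on finitely many elements the
    identity factors through a free module of finite rank. *)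
Definition dual_basis (T : pzRingType) (Q : lmodType T) : Prop :=
  forall s : seq Q, exists (n : nat) (v : {linear 'rV[T]_n -> Q})
    (w : {linear Q -> 'rV[T]_n}), {in s, forall z, v (w z) = z}.

Lemma linear_ext (T : pzRingType) (M N : lmodType T) (f : M -> N) :
  linear f -> exists g : {linear M -> N}, g =1 f.
Proof.
move=> fL.
pose F := GRing.isLinear.Build T M N *:%R f fL.
by exists (HB.pack_for {linear M -> N} f F).
Qed.

Section Correction.
Variables (T : pzRingType) (J : T -> Prop).
Hypotheses (JI : two_sided_ideal J) (srJ : ideal_sr1 J).
Variable Q : lmodType T.
Hypothesis QJ : ideal_full J Q.

Lemma ideal_full_coord n (w : {linear Q -> 'rV[T]_n}) z j : J (w z 0 j).
Proof.
have [l [q [r [Jr ->]]]] := QJ z; rewrite linear_sum summxE.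
apply: entrywise_sum => // i; rewrite linearZ mxE.
by case: JI => _ _ _ JM; apply: JM.
Qed.

(** Stable rank one for the endomorphism 1 + k of Q, where the image of k is
    fixed by v w. Sandwiching between v and w turns the equation
    x (1 + k) + b = 1 into one between matrices, with 1 + w k v in place of
    1 + k. The correction Y found there is brought back as v Y w, and the
    endomorphism 1 + v m obtained in this way, where m = w k + Y w b, is
    invertible because 1 + m v is. *)
Lemma correct_endomorphism n (v : {linear 'rV[T]_n -> Q})
    (w : {linear Q -> 'rV[T]_n}) (k x b : {linear Q -> Q}) :
    (forall z, v (w (k z)) = k z) -> (forall z, x (z + k z) + b z = z) ->
  exists u u' : {linear Q -> Q}, [/\ cancel u u', cancel u' u,
    forall z, b z = 0 -> u z = z + k z & forall z, exists c, u z = z + v c].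
Proof.
move=> vwk xkb.
pose mx (f : {linear Q -> Q}) : 'M[T]_n := lin1_mx (w \o f \o v).
have mulE f c : c *m mx f = w (f (v c)) by rewrite mul_rV_lin1.
pose A := 1%:M + mx k; pose X := 1%:M + (mx x - mx idfun).
have rV_ext (C D : 'M[T]_n) : (forall c : 'rV_n, c *m C = c *m D) -> C = D.
  by move=> CD; apply/row_matrixP => i; rewrite !rowE.
have [||Y [N [AYN NAY]]] := @ideal_sr1_matrix T J JI n srJ A X (mx b).
- move=> i j; rewrite addrC addKr mxE; exact: ideal_full_coord.
- apply: rV_ext => c; rewrite mulmxDr [A * X]/(A *m X) mulmxA mulmx1.
  have cA : v (c *m A) = v c + k (v c) by rewrite mulmxDr mulmx1 mulE linearD vwk.
  have key : w (x (v (c *m A))) + w (b (v c)) = w (v c).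
    by rewrite -linearD cA xkb.
  rewrite mulmxDr mulmxBr mulmx1 !mulE -addrA (addrAC (w _)) key cA linearD opprD.
  by rewrite (addrA (w (v c))) subrr sub0r mulmxDr mulmx1 mulE addrK.
have [m mE] : exists m : {linear Q -> 'rV[T]_n},
    forall z, m z = w (k z) + w (b z) *m Y.
  by exists ((w \o k) \+ (mulmxr Y \o (w \o b))).
have vm c : m (v c) = c *m (A + mx b * Y) - c.
  rewrite mE -[mx b * Y]/(mx b *m Y) !mulmxDr mulmx1 mulmxA !mulE.
  by rewrite -(addrA c) (addrC c) addrK.
have AYNK c : c *m (A + mx b * Y) *m N = c by rewrite -mulmxA [_ *m N]AYN mulmx1.
have NAYK c : c *m N *m (A + mx b * Y) = c by rewrite -mulmxA [N *m _]NAY mulmx1.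
exists (idfun \+ (v \o m)), (idfun \- (v \o (mulmxr N \o m))).
split=> [z|z|z bz|z].
- rewrite -[RHS](addrK (v (m z))) /= -/(m z); congr (_ - v _).
  by rewrite linearD vm addrC subrK AYNK.
- rewrite -[RHS](subrK (v (m z *m N))); congr (_ + v _).
  by rewrite [LHS]linearB /= vm NAYK opprB addrC subrK.
- by rewrite /= -/(m z) mE bz linear0 mul0mx addr0 vwk.
- by exists (m z).
Qed.

(** Any two finite-rank maps split on s differ on s by an automorphism of Q.
    On g(s) the endomorphism a = f g' does what u should do, x = g f' undoes
    it, and so b = 1 - x a vanishes there. Correcting a by multiples of b is
    therefore harmless, but a has finite rank and is not a perturbation of the
    identity; a + b = 1 + (a - x a) is one, and satisfies
    x (a + b) + (1 - x) b = 1. *)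
Lemma align_splittings (P : lmodType T) (s : seq P) (f g : {linear P -> Q})
    (f' g' : {linear Q -> P}) n (v : {linear 'rV[T]_n -> Q})
    (w : {linear Q -> 'rV[T]_n}) :
    {in s, forall x, f' (f x) = x} -> {in s, forall x, g' (g x) = x} ->
    (forall x, v (w (f x)) = f x) -> (forall x, v (w (g x)) = g x) ->
  exists u u' : {linear Q -> Q}, [/\ cancel u u', cancel u' u,
    {in s, forall x, u (g x) = f x} & forall z, exists c, u z = z + v c].
Proof.
move=> f'f g'g vwf vwg.
pose a : {linear Q -> Q} := f \o g'; pose x : {linear Q -> Q} := g \o f'.
pose k : {linear Q -> Q} := a \- (x \o a).
pose t : {linear Q -> Q} := idfun \- (x \o a).
have [z|z|u [u' [uK u'K ub uv]]] := @correct_endomorphism n v w k x (t \- (x \o t)).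
- by rewrite /= (linearB w) (linearB v) /= vwf vwg.
- have -> : z + k z = a z + t z by rewrite /= addrCA.
  rewrite (linearD x) -[RHS](subrK (x (a z))) -[X in _ + X]/(t z - x (t z)) -addrA.
  by rewrite (addrCA (x (t z))) subrr addr0 addrC.
exists u, u'; split=> // y ys.
have ag : a (g y) = f y by rewrite /= g'g.
have xf : x (f y) = g y by rewrite /= f'f.
have tg : t (g y) = 0 by rewrite -[LHS]/(g y - x (a (g y))) ag xf subrr.
have kg : k (g y) = f y - g y by rewrite -[LHS]/(a (g y) - x (a (g y))) ag xf.
rewrite ub; first by rewrite kg addrC subrK.
by rewrite -[LHS]/(t (g y) - x (t (g y))) tg linear0 subr0.
Qed.

End Correction.

(** * Limits of linear maps and intertwining *)

Definition generates (T : pzRingType) (P : lmodType T) (g : nat -> P) : Prop :=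
  forall x : P, exists (n : nat) (c : 'I_n -> T), x = \sum_(i < n) c i *: g i.

Definition locally_split (T : pzRingType) (P Q : lmodType T)
    (f : {linear P -> Q}) : Prop :=
  forall s : seq P, exists f' : {linear Q -> P}, {in s, forall x, f' (f x) = x}.

(** The last clause says that f has finite rank, by means of an endomorphism
    v w of Q that factors through a free module of finite rank and fixes the
    values of f; this is the form needed to align f with other maps. *)
Definition approximable (T : pzRingType) (P Q : lmodType T) : Prop :=
  forall s : seq P, exists (f : {linear P -> Q}) (f' : {linear Q -> P}),
    {in s, forall x, f' (f x) = x} /\
    exists n (v : {linear 'rV[T]_n -> Q}) (w : {linear Q -> 'rV[T]_n}),
      forall x, v (w (f x)) = f x.

Section Generators.
Variables (T : pzRingType) (P Q : lmodType T).

Lemma eq_on_generators (g : nat -> P) (f1 f2 : {linear P -> Q}) n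
    (c : 'I_n -> T) :
    {in mkseq g n, forall x, f1 x = f2 x} ->
  f1 (\sum_(i < n) c i *: g i) = f2 (\sum_(i < n) c i *: g i).
Proof.
move=> f12; rewrite !linear_sum; apply: eq_bigr => i _; rewrite !linearZ f12 //.
by apply: map_f; rewrite mem_iota /= ltn_ord.
Qed.

Lemma mkseqS_sub (g : nat -> P) m n :
  (m <= n)%N -> {subset mkseq g m <= mkseq g n}.
Proof.
move=> mn x /mapP[i]; rewrite mem_iota /= => im ->; apply: map_f.
by rewrite mem_iota /= (leq_trans im).
Qed.

End Generators.

Section Limits.
Variables (T : pzRingType) (P Q : lmodType T).

Lemma linear_limit (F : nat -> {linear P -> Q}) :
    (forall x, exists n, forall m, (n <= m)%N -> F m x = F n x) ->
  exists L : {linear P -> Q}, forall s : seq P, exists n,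
    forall m, (n <= m)%N -> {in s, forall x, L x = F m x}.
Proof.
move=> /choice[N FN].
have FE x m : (N x <= m)%N -> F m x = F (N x) x by apply: FN.
have [|L LE] := @linear_ext T P Q (fun x => F (N x) x).
  move=> a x y; pose m := maxn (N (a *: x + y)) (maxn (N x) (N y)).
  rewrite -!(FE _ m) ?linearP ?leq_maxl //.
    by rewrite /m (maxnA (N _)) leq_maxr.
  by rewrite /m maxnCA leq_maxl.
exists L; elim=> [|x s [n IHn]]; first by exists 0%N.
exists (maxn n (N x)) => m; rewrite geq_max => /andP[nm Nm] y; rewrite inE.
by case/predU1P => [->|ys]; [rewrite LE FE | rewrite (IHn m)].
Qed.

Fixpoint comp_upto (u : nat -> {linear Q -> Q}) n : {linear Q -> Q} :=
  if n is n'.+1 then comp_upto u n' \o u n' else idfun.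

Fixpoint comp_downto (u : nat -> {linear Q -> Q}) n : {linear Q -> Q} :=
  if n is n'.+1 then u n' \o comp_downto u n' else idfun.

(** One-sided intertwining: the maps u_0 ... u_(n-1) f_n agree with their
    successors on the first n generators. Composing with the automorphisms in
    this order, and not straightening f_(n+1) against an already straightened
    f_n, keeps each u_n independent of the earlier ones; this is what allows
    all of them to preserve one and the same K. *)
Lemma locally_split_limit (g : nat -> P) (f : nat -> {linear P -> Q})
    (f' : nat -> {linear Q -> P}) (u u' : nat -> {linear Q -> Q}) (K : Q -> Prop) :
    generates g ->
    (forall n, {in mkseq g n, forall x, f' n (f n x) = x}) ->
    (forall n, cancel (u n) (u' n)) ->
    (forall n, {in mkseq g n, forall x, u n (f n.+1 x) = f n x}) ->
    (forall n z, K z -> K (u n z)) -> (forall n x, K (f n x)) ->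
  exists L : {linear P -> Q}, locally_split L /\ forall x, K (L x).
Proof.
move=> gP f'f uK uf Ku Kf.
pose F n : {linear P -> Q} := comp_upto u n \o f n.
have stable n m : (n <= m)%N -> {in mkseq g n, forall x, F m x = F n x}.
  move=> /subnK <-; elim: (m - n)%N => // d IHd x xn.
  by rewrite -IHd //= uf //; apply: mkseqS_sub xn; rewrite leq_addl.
have cK n : cancel (comp_upto u n) (comp_downto u' n).
  by elim: n => //= n IHn z /=; rewrite IHn uK.
have [|L LE] := @linear_limit F.
  move=> x; have [n [c ->]] := gP x; exists n => m nm.
  by apply: eq_on_generators; apply: stable.
exists L; split=> [s|x].
  have [n Ln] := LE s.
  have [N sN] : exists N, forall m, (N <= m)%N ->
      {in s, forall x, f' m (f m x) = x}.
    elim: s {Ln} => [|x s [N IHN]]; first by exists 0%N.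
    have [k [c xE]] := gP x; exists (maxn N k) => m.
    rewrite geq_max => /andP[Nm km] y; rewrite inE.
    case/predU1P => [->|]; last exact: IHN.
    rewrite xE; apply: (@eq_on_generators _ _ _ g (f' m \o f m) idfun) => z zk /=.
    by apply: f'f; apply: mkseqS_sub zk.
  exists (f' (maxn n N) \o comp_downto u' (maxn n N)) => x xs.
  by rewrite (Ln (maxn n N)) ?leq_maxl //= cK sN // leq_maxr.
have [n /(_ n (leqnn n) x)->] := LE [:: x]; last by rewrite mem_head.
rewrite /=; elim: n (f n x) (Kf n x) => //= n IHn z Kz; exact/IHn/Ku.
Qed.

(** Two-sided intertwining. The limit of the f_n is injective since f_n is
    split on s_n, and surjective since the last hypothesis puts every
    generator of Q in the image of the stable part. *)
Lemma back_and_forth_limit (gP : nat -> P) (gQ : nat -> Q) (s : nat -> seq P)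
    (f : nat -> {linear P -> Q}) (f' : nat -> {linear Q -> P}) :
    generates gP -> generates gQ ->
    (forall n, {in s n, forall x, f' n (f n x) = x}) ->
    (forall n, {in s n, forall x, f n.+1 x = f n x}) ->
    (forall n, {subset s n <= s n.+1}) ->
    (forall n, {subset mkseq gP n <= s n.+1}) ->
    (forall n, {in mkseq gQ n, forall y, exists2 x, x \in s n.+1 & f n.+1 x = y}) ->
  isomorphic P Q.
Proof.
move=> gPP gQP f'f fS sS gs Qs.
have sub n m : (n <= m)%N -> {subset s n <= s m}.
  by move=> /subnK <-; elim: (m - n)%N => // d IHd x /IHd /sS.
have stable n m : (n <= m)%N -> {in s n, forall x, f m x = f n x}.
  move=> /subnK <-; elim: (m - n)%N => // d IHd x xn.
  by rewrite -IHd // fS //; apply: sub xn; rewrite leq_addl.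
have split n m : (n < m)%N -> forall c : 'I_n -> T,
    f' m (f m (\sum_(i < n) c i *: gP i)) = \sum_(i < n) c i *: gP i.
  move=> nm c; apply: (@eq_on_generators _ _ _ gP (f' m \o f m) idfun) => x xn /=.
  by apply: f'f; apply: sub (gs _ _ xn).
have [|L LE] := @linear_limit f.
  move=> x; have [n [c ->]] := gPP x; exists n.+1 => m nm.
  by apply: eq_on_generators => z /gs; apply: stable.
have Linj : injective L.
  move=> x y Lxy; have [n Ln] := LE [:: x; y].
  have [k [c xE]] := gPP x; have [l [d yE]] := gPP y.
  pose m := maxn n (maxn k.+1 l.+1).
  have nm : (n <= m)%N by rewrite leq_maxl.
  have km : (k < m)%N by rewrite /m maxnCA leq_maxl.
  have lm : (l < m)%N by rewrite /m (maxnC k.+1) maxnCA leq_maxl.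
  have := congr1 (f' m) Lxy; rewrite (Ln m) ?mem_head //.
  by rewrite (Ln m nm y) ?inE ?eqxx ?orbT // xE yE !split.
have Lsurj y : exists x, L x = y.
  have [n [c yE]] := gQP y.
  have Lgen i : exists x, i \in iota 0 n -> L x = gQ i.
    case: (boolP (i \in iota 0 n)) => [i_n|]; last by exists 0.
    have [|x xs fx] := Qs n (gQ i); first exact: map_f.
    exists x => _; have [k Lk] := LE [:: x].
    rewrite (Lk (maxn k n.+1)) ?leq_maxl ?mem_head //.
    by rewrite (stable n.+1) ?leq_maxr.
  have [h hE] := choice Lgen.
  exists (\sum_(i < n) c i *: h i); rewrite yE linear_sum.
  by apply: eq_bigr => i _; rewrite linearZ hE // mem_iota /= ltn_ord.
have [L' LK] := choice Lsurj.
by exists L, L' => // x; apply: Linj; rewrite LK.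
Qed.

End Limits.

(** * Dual bases and finite approximation *)

Section DualBasis.
Variable T : pzRingType.

Lemma dual_basis_frame (Q : lmodType T) n1 n2 (h1 : {linear 'rV[T]_n1 -> Q})
    (h2 : {linear 'rV[T]_n2 -> Q}) : dual_basis Q ->
  exists n (v : {linear 'rV[T]_n -> Q}) (w : {linear Q -> 'rV[T]_n}),
    (forall c, v (w (h1 c)) = h1 c) /\ (forall c, v (w (h2 c)) = h2 c).
Proof.
move=> QD.
pose basis m (h : {linear 'rV[T]_m -> Q}) := [seq h (delta_mx 0 i) | i : 'I_m].
have [n [v [w vw]]] := QD (basis _ h1 ++ basis _ h2); exists n, v, w.
have ext m (h : {linear 'rV[T]_m -> Q}) :
    {in basis m h, forall z, v (w z) = z} -> forall c, v (w (h c)) = h c.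
  move=> vwh c; rewrite [c]row_sum_delta !linear_sum; apply: eq_bigr => i _.
  by rewrite !linearZ vwh // image_f.
by split; apply: ext => z zh; apply: vw; rewrite mem_cat zh ?orbT.
Qed.

Lemma fg_row n : finitely_generated 'rV[T]_n.
Proof.
exists n, (delta_mx 0) => x; exists (x 0); exact: row_sum_delta.
Qed.

(** The maps that witness P <~ Q are defined on a finitely generated submodule
    of P. Precomposing with an endomorphism v w of P that fixes s and takes
    its values in the image of v extends them to P. *)
Lemma precsim_approximable (P Q : lmodType T) :
  dual_basis P -> dual_basis Q -> precsim P Q -> approximable P Q.
Proof.
move=> PD QD PQ s; have [n [v [w vw]]] := PD s.
have [phi [psi E]] := PQ _ (fg_im v (fg_row n)).
exists (phi \o (corestr v \o w)), psi; split=> [x xs|] /=; first by rewrite E /= vw.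
have [m [a [b [ab _]]]] :=
  dual_basis_frame (phi \o corestr v) (phi \o corestr v) QD.
by exists m, a, b => x; apply: ab.
Qed.

(** A single v and w serve for all s: they are chosen to fix the finitely
    generated submodule Y of the definition of P < Q. *)
Lemma prec_approximable (P Q : lmodType T) :
  dual_basis P -> dual_basis Q -> prec P Q ->
  exists n (v : {linear 'rV[T]_n -> Q}) (w : {linear Q -> 'rV[T]_n}),
    forall s : seq P, exists (f : {linear P -> Q}) (f' : {linear Q -> P}),
      {in s, forall x, f' (f x) = x} /\ forall x, v (w (f x)) = f x.
Proof.
move=> PD QD [Y [[k [y yP]] PQ]].
have [m [a [b ab]]] := QD [seq val (y i) | i : 'I_k].
exists m, a, b => s; have [n [v [w vw]]] := PD s.
have [phi [psi [E phiY]]] := PQ _ (fg_im v (fg_row n)).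
exists (phi \o (corestr v \o w)), psi; split=> [x xs|x] /=.
  by rewrite E /= vw.
have [c /(congr1 (submod_incl Y))] := yP (Submod (phiY (corestr v (w x)))).
rewrite [LHS]/= => ->; rewrite !linear_sum; apply: eq_bigr => i _.
by rewrite !linearZ ab // image_f.
Qed.

Lemma sum_coef_widen (S : nzRingType) (P : lmodType S) (g : nat -> P)
    (p : {poly S}) n :
  (size p <= n)%N -> \sum_(i < size p) p`_i *: g i = \sum_(i < n) p`_i *: g i.
Proof.
move=> pn; rewrite -!(big_mkord xpredT (fun i => p`_i *: g i)).
rewrite (big_cat_nat (leq0n _) pn) /= [X in _ + X]big1_seq ?addr0 // => i.
by rewrite mem_index_iota => /andP[_ /andP[pi _]]; rewrite nth_default ?scale0r.
Qed.

(** The module of polynomials serves as a free module of countable rank, with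
    basis the powers of the variable; lifting the identity of P to it
    expresses every element by finitely many coefficients. *)
Lemma projective_dual_basis (S : nzRingType) (P : lmodType S) :
  countably_generated P -> projective P -> dual_basis P.
Proof.
move=> [g gP] PP.
have [|G GE] := @linear_ext S {poly S} P (fun p => \sum_(i < size p) p`_i *: g i).
  move=> a p q; pose n := maxn (size (a *: p + q)) (maxn (size p) (size q)).
  rewrite (sum_coef_widen _ (n := n)) ?leq_maxl //.
  rewrite (sum_coef_widen g (p := p) (n := n)); last first.
    by rewrite /n maxnCA leq_maxl.
  rewrite (sum_coef_widen g (p := q) (n := n)); last first.
    by rewrite /n (maxnA (size _)) leq_maxr.
  rewrite scaler_sumr -big_split; apply: eq_bigr => i _ /=.
  by rewrite coefD coefZ scalerDl scalerA.
have [|h hE] := PP _ _ G (@idfun P).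
  move=> y; have [n [c ->]] := gP y; exists (\sum_(i < n) c i *: 'X^i).
  rewrite linear_sum; apply: eq_bigr => i _; rewrite linearZ GE size_polyXn.
  rewrite big_ord_recr /= coefXn eqxx scale1r big1 ?add0r // => j _.
  by rewrite coefXn ltn_eqF ?scale0r.
move=> s; pose n := \max_(x <- s) size (h x).
have [|v vE] := @linear_ext S 'rV[S]_n P (fun c => \sum_i c 0 i *: g i).
  move=> a x y; rewrite scaler_sumr -big_split; apply: eq_bigr => i _ /=.
  by rewrite !mxE scalerDl scalerA.
have [|w wE] := @linear_ext S P 'rV[S]_n (fun x => \row_i (h x)`_i).
  by move=> a x y; apply/rowP => i; rewrite !mxE linearP coefD coefZ.
exists n, v, w => x xs; rewrite vE wE -[RHS]/(@idfun P x) -hE GE.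
under eq_bigr => i _ do rewrite mxE.
have hn : (size (h x) <= n)%N.
  by apply: (leq_bigmax_seq (F := fun x => size (h x))) xs _.
exact: esym (sum_coef_widen g hn).
Qed.

End DualBasis.

(** * Embeddings and isomorphisms from finite approximations *)

Section Intertwining.
Variables (T : pzRingType) (J : T -> Prop).
Hypotheses (JI : two_sided_ideal J) (srJ : ideal_sr1 J).
Variables P Q : lmodType T.
Variable gP : nat -> P.
Hypotheses (gPP : generates gP) (PD : dual_basis P) (PJ : ideal_full J P).
Hypotheses (QD : dual_basis Q) (QJ : ideal_full J Q).

(** Each f_(n+1) is aligned with f_n inside a free module of finite rank that
    covers both images; K only has to be stable under translation by the
    image of that module, because the aligning automorphism is the identity
    modulo it. *)
Lemma aligned_embedding (F : nat -> {linear P -> Q} * {linear Q -> P})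
    (K : Q -> Prop) :
    (forall n, {in mkseq gP n, forall x, (F n).2 ((F n).1 x) = x}) ->
    (forall n, exists m (v : {linear 'rV[T]_m -> Q}) (w : {linear Q -> 'rV[T]_m}),
      [/\ forall x, v (w ((F n).1 x)) = (F n).1 x,
          forall x, v (w ((F n.+1).1 x)) = (F n.+1).1 x &
          forall z c, K z -> K (z + v c)]) ->
    (forall n x, K ((F n).1 x)) ->
  exists f : {linear P -> Q}, locally_split f /\ forall x, K (f x).
Proof.
move=> F_split frame KF.
have /choice[u uE] : forall n, exists U : {linear Q -> Q} * {linear Q -> Q},
    [/\ cancel U.1 U.2, {in mkseq gP n, forall x, U.1 ((F n.+1).1 x) = (F n).1 x}
      & forall z, K z -> K (U.1 z)].
  move=> n; have [m [v [w [vw0 vw1 Kv]]]] := frame n.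
  have split1 : {in mkseq gP n, forall x, (F n.+1).2 ((F n.+1).1 x) = x}.
    by move=> x xn; apply: F_split; apply: mkseqS_sub xn.
  have [U [U' [UK _ UF Uv]]] :=
    align_splittings JI srJ QJ (F_split n) split1 vw0 vw1.
  by exists (U, U'); split=> // z Kz; have [c ->] := Uv z; apply: Kv.
apply: (@locally_split_limit _ _ _ gP (fun n => (F n).1) (fun n => (F n).2)
  (fun n => (u n).1) (fun n => (u n).2) K) => //.
- by move=> n; have [] := uE n.
- by move=> n; have [] := uE n.
- by move=> n; have [] := uE n.
Qed.

Lemma approximable_embedding :
  approximable P Q -> exists f : {linear P -> Q}, locally_split f.
Proof.
move=> PQ.
have /choice[F FE] : forall n, exists F : {linear P -> Q} * {linear Q -> P},
    {in mkseq gP n, forall x, F.2 (F.1 x) = x} /\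
    exists m (v : {linear 'rV[T]_m -> Q}) (w : {linear Q -> 'rV[T]_m}),
      forall x, v (w (F.1 x)) = F.1 x.
  by move=> n; have [f [f' fE]] := PQ (mkseq gP n); exists (f, f').
have [n|n|//|f [fs _]] := @aligned_embedding F (fun=> True).
- by have [] := FE n.
- have [_ [n0 [v0 [w0 E0]]]] := FE n; have [_ [n1 [v1 [w1 E1]]]] := FE n.+1.
  have [m [v [w [vw0 vw1]]]] := dual_basis_frame v0 v1 QD.
  exists m, v, w; split=> // x; first by rewrite -E0 vw0.
  by rewrite -E1 vw1.
by exists f.
Qed.

Lemma approximable_fg_embedding n (v : {linear 'rV[T]_n -> Q})
    (w : {linear Q -> 'rV[T]_n}) :
    (forall s : seq P, exists (f : {linear P -> Q}) (f' : {linear Q -> P}),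
      {in s, forall x, f' (f x) = x} /\ forall x, v (w (f x)) = f x) ->
  exists f : {linear P -> Q}, locally_split f /\ forall x, exists c, f x = v c.
Proof.
move=> PQ.
have /choice[F FE] : forall k, exists F : {linear P -> Q} * {linear Q -> P},
    {in mkseq gP k, forall x, F.2 (F.1 x) = x} /\
    forall x, v (w (F.1 x)) = F.1 x.
  by move=> k; have [f [f' fE]] := PQ (mkseq gP k); exists (f, f').
apply: (@aligned_embedding F (fun z => exists c, z = v c)) => [k|k|k x].
- by have [] := FE k.
- have [_ E0] := FE k; have [_ E1] := FE k.+1.
  exists n, v, w; split=> // _ d [c ->].
  by exists (c + d); rewrite linearD.
by exists (w ((F k).1 x)); have [] := FE k.
Qed.

(** One half of the back-and-forth step. Approximate Q on t by any h; then h f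
    and the identity are two maps P -> P split on s, and an automorphism of P
    aligns them. A finite-rank map v0 w0 stands in for the identity, with
    which it agrees on s. *)
Lemma approximable_return (s : seq P) (f : {linear P -> Q}) (f' : {linear Q -> P})
    (t : seq Q) :
    approximable Q P -> {in s, forall x, f' (f x) = x} ->
    {subset map f s <= t} ->
  exists (h : {linear Q -> P}) (h' : {linear P -> Q}),
    {in t, forall y, h' (h y) = y} /\ {in s, forall x, h (f x) = x}.
Proof.
move=> QP f'f st; have [h [h' [h'h [n1 [v1 [w1 E1]]]]]] := QP t.
have [n0 [v0 [w0 E0]]] := PD s.
have [m [v [w [vw0 vw1]]]] := dual_basis_frame v0 v1 PD.
have [x xs||x|x|u [u' [uK _ us _]]] := @align_splittings T J JI srJ P PJ P s
  (v0 \o w0) (h \o f) idfun (f' \o h') m v w.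
- by rewrite /= E0.
- move=> x xs /=; rewrite h'h ?f'f //; apply: st; exact: map_f.
- exact: vw0.
- by rewrite /= -E1 vw1.
exists (u \o h), (h' \o u'); split=> [y yt|x xs] /=; first by rewrite uK h'h.
by have /= := us x xs; rewrite E0.
Qed.

End Intertwining.

(** The states of the construction are maps f : P -> Q with a left inverse f'
    on a finite set s. One step sends f to a return map h : Q -> P, and h to a
    new map P -> Q; the new map agrees with f on s because both undo h on
    f(s). *)
Lemma approximable_isomorphic (T : pzRingType) (J : T -> Prop) (P Q : lmodType T)
    (gP : nat -> P) (gQ : nat -> Q) :
    two_sided_ideal J -> ideal_sr1 J ->
    generates gP -> dual_basis P -> ideal_full J P ->
    generates gQ -> dual_basis Q -> ideal_full J Q ->
  approximable P Q -> approximable Q P -> isomorphic P Q.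
Proof.
move=> JI srJ gPP PD PJ gQP QD QJ PQ QP.
pose state := {S : {linear P -> Q} * {linear Q -> P} * seq P |
  {in S.2, forall x, S.1.2 (S.1.1 x) = x}}.
pose next n (S S' : state) :=
  [/\ {in (sval S).2, forall x, (sval S').1.1 x = (sval S).1.1 x},
      {subset (sval S).2 <= (sval S').2}, {subset mkseq gP n <= (sval S').2} &
      {in mkseq gQ n, forall y,
        exists2 x, x \in (sval S').2 & (sval S').1.1 x = y}].
have /choice[step stepP] : forall a : nat * state, exists S', next a.1 a.2 S'.
  move=> [n [[[f f'] s] /= f'f]]; pose t := map f s ++ mkseq gQ n.
  have [|h [h' [h'h hf]]] := approximable_return JI srJ PD PJ (t := t) QP f'f.
    by move=> y ys; rewrite mem_cat ys.
  pose s' := map h t ++ mkseq gP n.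
  have [|k [k' [k'k kh]]] := approximable_return JI srJ QD QJ (t := s') PQ h'h.
    by move=> y ys; rewrite mem_cat ys.
  have ft x : x \in s -> f x \in t by move=> xs; rewrite mem_cat map_f.
  exists (exist _ (k, k', s') k'k); split=> /= [x xs|x xs|x xn|y yn].
  - by rewrite -{1}(hf x xs) kh ?ft.
  - by rewrite -(hf x xs) mem_cat map_f ?ft.
  - by rewrite mem_cat xn orbT.
  have yt : y \in t by rewrite mem_cat yn orbT.
  by exists (h y); [rewrite mem_cat map_f | rewrite kh].
have S0 : state by exists ((\0 : {linear P -> Q}), (\0 : {linear Q -> P}), [::]).
pose fix S n : state := if n is n'.+1 then step (n', S n') else S0.
have SP n : next n (S n) (S n.+1) by apply: (stepP (n, S n)).
apply: (@back_and_forth_limit _ _ _ gP gQ (fun n => (sval (S n)).2)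
  (fun n => (sval (S n)).1.1) (fun n => (sval (S n)).1.2)) => // n.
- exact: (svalP (S n)).
- by have [] := SP n.
- by have [] := SP n.
- by have [] := SP n.
- by have [] := SP n.
Qed.

(** * Quotient modules *)

Section QuotientModule.
Variables (S : pzRingType) (V : lmodType S) (N : submodClosed V).

(** The additive group underlying N: the quotient is taken as one of additive
    groups first, and given its scaling afterwards. *)
Definition submod_group : {pred V} := fun x => x \in N.

Lemma submod_group_closed : zmod_closed submod_group.
Proof.
split=> [|x y xN yN]; rewrite /submod_group -!topredE /=; first exact: rpred0.
by rewrite -scaleN1r rpredD // rpredZ.
Qed.

HB.instance Definition _ := GRing.isZmodClosed.Build V submod_group
  submod_group_closed.

Definition quot_mod : Type := Quotient.quot submod_group.
HB.instance Definition _ := GRing.Zmodule.on quot_mod.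

Definition quot_pi (x : V) : quot_mod := \pi_(Quotient.quot submod_group)%qT x.
Definition quot_repr (q : quot_mod) : V := repr (q : Quotient.quot submod_group).

Lemma quot_reprK q : quot_pi (quot_repr q) = q.
Proof. exact: reprK. Qed.

Lemma quot_piP x y : quot_pi x = quot_pi y <-> x - y \in N.
Proof.
rewrite -[x - y \in N]/(x - y \in submod_group) Quotient.idealrBE.
by split=> /eqP.
Qed.

Lemma quot_piD x y : quot_pi (x + y) = quot_pi x + quot_pi y.
Proof. exact: raddfD. Qed.

Definition quot_scale (a : S) (q : quot_mod) : quot_mod :=
  quot_pi (a *: quot_repr q).

Lemma quot_piZ a x : quot_pi (a *: x) = quot_scale a (quot_pi x).
Proof.
apply/quot_piP; rewrite -scalerBr rpredZ //; apply/quot_piP.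
by rewrite quot_reprK.
Qed.

Lemma quot_scaleA a b q : quot_scale a (quot_scale b q) = quot_scale (a * b) q.
Proof. by rewrite -[q]quot_reprK -!quot_piZ scalerA. Qed.

Lemma quot_scale1 : left_id 1 quot_scale.
Proof. by move=> q; rewrite -[q]quot_reprK -!quot_piZ scale1r. Qed.

Lemma quot_scaleDr : right_distributive quot_scale +%R.
Proof.
move=> a p q; rewrite -[p]quot_reprK -[q]quot_reprK -quot_piD -!quot_piZ.
by rewrite scalerDr quot_piD.
Qed.

Lemma quot_scaleDl q : {morph quot_scale^~ q : a b / a + b}.
Proof.
by move=> a b; rewrite -[q]quot_reprK -!quot_piZ scalerDl quot_piD.
Qed.

HB.instance Definition _ := GRing.Zmodule_isLmodule.Build S quot_mod
  quot_scaleA quot_scale1 quot_scaleDr quot_scaleDl.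

Lemma quot_pi_linear : linear quot_pi.
Proof. by move=> a x y; rewrite quot_piD quot_piZ. Qed.

HB.instance Definition _ := GRing.isLinear.Build S V quot_mod *:%R quot_pi
  quot_pi_linear.

End QuotientModule.

(** * Purity and local splitting *)

Lemma locally_split_inj (T : pzRingType) (P Q : lmodType T) (f : {linear P -> Q}) :
  locally_split f -> injective f.
Proof.
move=> fS x y fxy; have [f' f'f] := fS [:: x; y].
by rewrite -(f'f x) ?fxy ?f'f ?inE ?eqxx ?orbT.
Qed.

Lemma corestr_surj (T : pzRingType) (P Q : lmodType T) (f : {linear P -> Q})
  (y : submod (im_pred f)) : exists x, corestr f x = y.
Proof. by case: y => y yf; have /asboolP[x fx] := yf; exists x; apply: val_inj. Qed.

Lemma isomorphic_im (T : pzRingType) (P Q : lmodType T) (f : {linear P -> Q}) :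
  injective f -> isomorphic P (submod (im_pred f)).
Proof.
move=> f_inj; exists (corestr f).
have /choice[g gE] := @corestr_surj _ _ _ f.
exists g => // x; apply: f_inj; exact: (congr1 (submod_incl _) (gE (corestr f x))).
Qed.

Section Purity.
Variable S : pzRingType.

(** Two tensors over the image of f involve finitely many elements, on which
    some linear map Q -> im f is the identity; functoriality of the tensor
    product along that map carries an equality in Q back to the image. *)
Lemma locally_split_pure (P Q : rmodType S) (f : {linear P -> Q}) :
  locally_split f -> pure (im_pred f).
Proof.
move=> fS X t t'; rewrite -[t]tensor_reprK -[t']tensor_reprK.
move: (tensor_repr t) (tensor_repr t') => {t t'} s s'.
rewrite !tensor_mapE => /tensor_piP eq_ss'; apply/tensor_piP.
have /choice[g gE] := @corestr_surj _ _ _ f.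
have [f' f'f] := fS [seq g z.1 | z <- s ++ s'].
pose r : {linear Q -> submod (im_pred f)} := corestr f \o f'.
have rK z : z \in s ++ s' -> r (val z.1) = z.1.
  move=> zs; rewrite -{1}(gE z.1) /= f'f ?gE //.
  exact: (map_f (fun z : _ * X => g z.1)).
have rmap u : {subset u <= s ++ s'} ->
    [seq (r z.1, z.2) | z <- [seq (submod_incl (im_pred f) z.1, z.2) | z <- u]] = u.
  move=> us; rewrite -map_comp -[RHS]map_id; apply/eq_in_map => -[y x] yx /=.
  by have /= -> := rK _ (us _ yx).
have := tensor_eq_map r eq_ss'.
by rewrite !rmap // => z zs; rewrite mem_cat zs ?orbT.
Qed.

Section TensorCalculus.
Variables (M : rmodType S) (X : lmodType S).
Implicit Types s t : seq (M * X).

Lemma tensor_eq_perm s t : perm_eq s t -> tensor_eq s t.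
Proof.
move=> st; apply: (catCA_perm_ind (P := tensor_eq s)) st _ => [s1 s2 s3 E|].
  apply: tensor_eq_trans E _; rewrite !catA.
  by apply: tensor_eq_cat; [exact: tensor_eq_catC | exact: tensor_eq_refl].
exact: tensor_eq_refl.
Qed.

Lemma tensor_eq_cons z s t : tensor_eq s t -> tensor_eq (z :: s) (z :: t).
Proof. by move=> st; apply: (tensor_eq_cat (tensor_eq_refl [:: z])). Qed.

Lemma tensor_eq_0r m : @tensor_eq S M X [:: (m, 0)] [::].
Proof.
apply: tensor_eq_trans (tensor_eq_0 M (0 : X)).
have := tensor_eq_Z 0 m (0 : X); rewrite !scale0r; exact: tensor_eq_sym.
Qed.

Lemma tensor_eq_suml (I : Type) (r : seq I) (F : I -> M) (x : X) :
  tensor_eq [:: (\sum_(i <- r) F i, x)] [seq (F i, x) | i <- r].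
Proof.
elim: r => [|i r IHr] /=; first by rewrite big_nil; exact: tensor_eq_0.
rewrite big_cons; apply: tensor_eq_trans (tensor_eq_Dl _ _ _) _.
exact: tensor_eq_cons.
Qed.

Lemma tensor_eq_map_Dr (I : Type) (r : seq I) (p : I -> M) (F G : I -> X) :
  tensor_eq ([seq (p i, F i) | i <- r] ++ [seq (p i, G i) | i <- r])
            [seq (p i, F i + G i) | i <- r].
Proof.
elim: r => [|i r IHr] /=; first exact: tensor_eq_refl.
apply: (@tensor_eq_trans _ _ _ _ ([:: (p i, F i); (p i, G i)] ++
  ([seq (p i, F i) | i <- r] ++ [seq (p i, G i) | i <- r]))).
  by apply: tensor_eq_perm; rewrite /= perm_cons -cat1s perm_catCA.
rewrite -[X in tensor_eq _ X]cat1s; apply: tensor_eq_cat => //.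
exact/tensor_eq_sym/tensor_eq_Dr.
Qed.

(** Moving the coefficients of a matrix across the tensor product exchanges
    its row and column sums. *)
Lemma tensor_eq_exchange (I K : Type) (r : seq I) (q : seq K) (c : I -> K -> S)
    (p : K -> M) (e : I -> X) :
  tensor_eq [seq (\sum_(k <- q) (c i k : S^c) *: p k, e i) | i <- r]
            [seq (p k, \sum_(i <- r) c i k *: e i) | k <- q].
Proof.
elim: r => [|i r IHr] /=.
  under eq_map => k do rewrite big_nil.
  elim: q => [|k q IHq] /=; first exact: tensor_eq_refl.
  apply: (tensor_eq_cat (s := [::]) (s' := [:: (p k, 0)]) _ IHq).
  exact/tensor_eq_sym/tensor_eq_0r.
under [X in tensor_eq _ X]eq_map => k do rewrite big_cons.
apply: tensor_eq_trans (tensor_eq_map_Dr _ _ _ _).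
rewrite -cat1s; apply: tensor_eq_cat IHr.
apply: tensor_eq_trans (tensor_eq_suml _ _ _) _.
elim: q => [|k q IHq] /=; first exact: tensor_eq_refl.
rewrite -cat1s -[X in tensor_eq _ X]cat1s.
by apply: tensor_eq_cat IHq; exact: tensor_eq_Z.
Qed.

End TensorCalculus.

(** The equational criterion. Let X be the left module with generators
    e_1, ..., e_l and relations the rows of C. The tensor of N with X is N^l
    modulo the families of the form (sum_j q_j C_ji)_i, and that quotient is
    described here by the relation [solvable_difference] on N^l. *)
Section Solvability.
Variables (N : rmodType S) (n l : nat) (C : 'M[S]_(n, l)).

Local Notation relations := (im_pred (mulmxr C : {linear 'rV[S]_n -> 'rV[S]_l})).

Definition solvable_difference (y y' : 'I_l -> N) : Prop :=
  exists q : 'I_n -> N, forall i, y i - y' i = \sum_j (C j i : S^c) *: q j.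

(** A representative in N^l of the tensor z. *)
Definition tensor_value (z : seq (N * quot_mod relations)) (i : 'I_l) : N :=
  \sum_(u <- z) (quot_repr u.2 0 i : S^c) *: u.1.

Lemma solvable_eq y y' : y =1 y' -> solvable_difference y y'.
Proof.
by move=> E; exists (fun=> 0) => i; rewrite E subrr big1 // => j _; rewrite scaler0.
Qed.

Lemma solvable_sym y y' : solvable_difference y y' -> solvable_difference y' y.
Proof.
move=> [q E]; exists (fun j => - q j) => i; rewrite -opprB E -sumrN.
by apply: eq_bigr => j _; rewrite scalerN.
Qed.

Lemma solvable_add y1 y1' y2 y2' :
    solvable_difference y1 y1' -> solvable_difference y2 y2' ->
  solvable_difference (fun i => y1 i + y2 i) (fun i => y1' i + y2' i).
Proof.
move=> [q E] [r F]; exists (fun j => q j + r j) => i.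
rewrite opprD addrACA E F -big_split; apply: eq_bigr => j _ /=.
by rewrite scalerDr.
Qed.

Lemma solvable_sum (U : Type) (r : seq U) (y y' : U -> 'I_l -> N) :
    (forall u, solvable_difference (y u) (y' u)) ->
  solvable_difference (fun i => \sum_(u <- r) y u i) (fun i => \sum_(u <- r) y' u i).
Proof.
move=> yy'; elim: r => [|u r IHr]; first by apply: solvable_eq => i; rewrite !big_nil.
have [q E] := solvable_add (yy' u) IHr; exists q => i.
by rewrite -E !big_cons.
Qed.

Lemma solvable_trans y1 y2 y3 :
    solvable_difference y1 y2 -> solvable_difference y2 y3 ->
  solvable_difference y1 y3.
Proof.
move=> E12 E23; have [q E] := solvable_add E12 E23; exists q => i.
by rewrite -E opprD addrA addrK.
Qed.

(** Representatives of one element of X differ by a combination of the rows of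
    C, and the coefficients of that combination times m solve the system. *)
Lemma solvable_repr (d e : 'rV[S]_l) (m : N) :
    quot_pi relations d = quot_pi _ e ->
  solvable_difference (fun i => (d 0 i : S^c) *: m) (fun i => (e 0 i : S^c) *: m).
Proof.
move/quot_piP/asboolP => [a aE].
exists (fun j => (a 0 j : S^c) *: m) => i.
under eq_bigr => j _ do rewrite scalerA.
rewrite -scaler_suml -scalerBl; congr (_ *: m).
by have := congr1 (fun A : 'rV_l => A 0 i) aE; rewrite !mxE => <-.
Qed.

Lemma tensor_value_eq z z' :
  tensor_eq z z' -> solvable_difference (tensor_value z) (tensor_value z').
Proof.
elim=> {z z'} [s|s t _|s t u _ + _|s s' t t' _ + _|s t|x|m m' x|m x x'|a m x].
- exact: solvable_eq.
- exact: solvable_sym.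
- exact: solvable_trans.
- move=> E F; have [q G] := solvable_add E F; exists q => i.
  by rewrite -G /tensor_value !big_cat.
- by apply: solvable_eq => i; rewrite /tensor_value !big_cat /= addrC.
- by apply: solvable_eq => i; rewrite /tensor_value big_seq1 big_nil scaler0.
- apply: solvable_eq => i.
  by rewrite /tensor_value !big_cons !big_nil !addr0 scalerDr.
- have [|q E] := @solvable_repr (quot_repr (x + x')) (quot_repr x + quot_repr x') m.
    by rewrite quot_piD !quot_reprK.
  exists q => i.
  by rewrite -E /tensor_value !big_cons !big_nil !addr0 /= -scalerDl mxE.
- have [|q E] := @solvable_repr (a *: quot_repr x) (quot_repr (a *: x)) m.
    by rewrite quot_piZ !quot_reprK.
  by exists q => i; rewrite -E /tensor_value !big_seq1 /= mxE scalerA.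
Qed.

End Solvability.

(** Let x_1, ..., x_l be the elements of s. A dual basis of M writes
    x_i = sum_j p_j C_ji with p_j in M, so the tensor of the x_i with the e_i
    vanishes over M, where it equals the tensor of the p_j with the relations.
    By purity it vanishes over N; hence x_i = sum_j q_j C_ji with q_j in N,
    and replacing p_j by q_j in the dual basis gives the retraction. *)
Lemma pure_retraction (M : rmodType S) (N : submodClosed M) :
    dual_basis M -> pure N ->
  forall s : seq (submod N), exists r : {linear M -> submod N},
    {in s, forall x, r (submod_incl N x) = x}.
Proof.
move=> MD Npure s; pose l := size s.
have [n [v [w vw]]] := MD (map (submod_incl N) s).
pose C : 'M[S]_(n, l) :=
  \matrix_(j, i) (w (submod_incl N (tnth (in_tuple s) i)) 0 j : S).
pose relations := im_pred (mulmxr C : {linear 'rV[S]_n -> 'rV[S]_l}).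
pose e (i : 'I_l) : quot_mod relations := quot_pi _ (delta_mx 0 i).
pose z := [seq (tnth (in_tuple s) i, e i) | i <- index_enum 'I_l].
have : tensor_pi z = tensor_pi [::].
  apply: Npure; rewrite !tensor_mapE; apply/tensor_piP => /=.
  have -> : [seq (submod_incl N u.1, u.2) | u <- z] =
      [seq (\sum_j (C j i : S^c) *: v (delta_mx 0 j), e i) | i <- index_enum 'I_l].
    rewrite -map_comp; apply: eq_map => i /=; congr pair.
    rewrite -[LHS]vw; last by apply: (map_f (submod_incl N)); exact: mem_tnth.
    rewrite [X in v X]row_sum_delta linear_sum; apply: eq_bigr => j _.
    by rewrite linearZ mxE.
  apply: tensor_eq_trans (tensor_eq_exchange _ _ (fun i j => C j i) _ _) _.
  have rel0 j : \sum_i C j i *: e i = 0.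
    transitivity (quot_pi relations (row j C)).
      rewrite [row j C]row_sum_delta linear_sum; apply: eq_bigr => i _.
      by rewrite linearZ [row j C 0 i]mxE.
    rewrite -(linear0 (quot_pi relations)); apply/quot_piP.
    by rewrite subr0 rowE; exact: mem_im.
  elim: (index_enum 'I_n) => [|j r IHr] /=; first exact: tensor_eq_refl.
  apply: (tensor_eq_cat (s := [:: _]) (s' := [::])) IHr.
  by rewrite rel0; exact: tensor_eq_0r.
move/tensor_piP/tensor_value_eq => [q0 z0].
have [q qE] : solvable_difference C (tnth (in_tuple s)) (fun=> 0).
  apply: (@solvable_trans _ _ _ C _ (tensor_value z)); last first.
    by exists q0 => i; rewrite -z0 /tensor_value [X in _ = _ - X]big_nil.
  apply: solvable_sym.
  have [i|q qE] := @solvable_sum _ _ _ C _ (index_enum 'I_l)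
    (fun i k => (quot_repr (e i) 0 k : S^c) *: tnth (in_tuple s) i)
    (fun i k => ((delta_mx 0 i : 'rV[S]_l) 0 k : S^c) *: tnth (in_tuple s) i).
    by apply: solvable_repr; rewrite quot_reprK.
  exists q => k; rewrite -qE /tensor_value big_map; congr (_ - _).
  rewrite (bigD1 k) //= mxE !eqxx scale1r big1 ?addr0 // => i ik.
  by rewrite mxE eqxx eq_sym (negPf ik) scale0r.
have [|r rE] := @linear_ext _ M (submod N) (fun x => \sum_j w x 0 j *: q j).
  move=> a x y; rewrite linearP scaler_sumr -big_split; apply: eq_bigr => j _ /=.
  by rewrite !mxE scalerDl scalerA.
exists r => x /(tnthP (in_tuple s))[k ->].
by rewrite rE -[RHS]subr0 qE; apply: eq_bigr => j _; rewrite mxE.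
Qed.

End Purity.

(** * From pure submodules back to the comparison relations *)

Lemma linear_inverse (T : pzRingType) (M N : lmodType T) (f : {linear M -> N}) :
  bijective f -> exists g : {linear N -> M}, cancel f g /\ cancel g f.
Proof.
case=> g fK gK; have [|h hE] := @linear_ext _ N M g; last first.
  by exists h; split=> x; rewrite hE.
by move=> a x y; apply: (can_inj fK); rewrite linearP !gK.
Qed.

Lemma isomorphic_precsim (T : pzRingType) (P Q : lmodType T) :
  isomorphic P Q -> precsim P Q /\ precsim Q P.
Proof.
move=> [f /linear_inverse[g [fK gK]]]; split=> X _.
  by exists (f \o submod_incl X), g => x; apply: fK.
by exists (g \o submod_incl X), f => x; apply: gK.
Qed.

(** Purity provides a map Q -> P' that fixes the images of the generators of
    X; followed by the isomorphism of P' with P, it is psi. *)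
Lemma pure_embedding_factor (S : pzRingType) (P Q : rmodType S)
    (P' : submodClosed Q) (X : submodClosed P) :
    dual_basis Q -> pure P' -> isomorphic P (submod P') ->
    finitely_generated (submod X) ->
  exists (phi : {linear submod X -> Q}) (psi : {linear Q -> P}),
    (forall x, psi (phi x) = submod_incl X x) /\ (forall x, phi x \in P').
Proof.
move=> QD P'pure [h /linear_inverse[h' [hK _]]] [n [g gX]].
have [r rE] := pure_retraction QD P'pure [seq h (submod_incl X (g i)) | i : 'I_n].
exists (submod_incl P' \o (h \o submod_incl X)), (h' \o r).
split=> x; last exact: valP.
rewrite -[LHS]/(h' (r (submod_incl P' (h (submod_incl X x))))).
have [c ->] := gX x; rewrite !linear_sum; apply: eq_bigr => i _.
by rewrite !linearZ rE ?image_f // hK.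
Qed.

(** * The Dorroh extension *)

Section Dorroh.
Variable R : rngType.
Local Notation T := (dorroh R)^c.

Definition in_rng (a : T) : Prop := exists r : R, a = dorroh_in r.

Lemma in_rngP (a : T) : (a : dorroh R).1 = 0 <-> in_rng a.
Proof. by split=> [|[r ->]] //; case: a => m r /= ->; exists r. Qed.

Lemma in_rng_ideal : two_sided_ideal in_rng.
Proof.
split=> [|x y /in_rngP x0 /in_rngP y0|a x /in_rngP x0|a x /in_rngP x0].
- exact/in_rngP.
- by apply/in_rngP; rewrite /= x0 y0.
- by apply/in_rngP; rewrite /= x0 mul0r.
- by apply/in_rngP; rewrite /= x0 mulr0.
Qed.

Lemma stable_rank_one_ideal : stable_rank_one R -> ideal_sr1 in_rng.
Proof.
move=> sr a x b Ja axb; have [y [u [E F]]] := sr a b x Ja axb.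
by exists y, u.
Qed.

Lemma eq_PR_ideal_full (P : lmodType T) : eq_PR P -> ideal_full in_rng P.
Proof.
move=> PR x; have [n [q [r ->]]] := PR x.
by exists n, q, (fun i => dorroh_in (r i)); split=> // i; exists (r i).
Qed.

End Dorroh.

(** * Comparison of countably generated projective modules *)

Theorem theorem4p9 (R : rngType) (P Q : cpModule R) :
  stable_rank_one R ->
  [/\ prec P Q <->
        (exists P' : submodClosed Q,
          [/\ pure P', isomorphic P (submod P') &
              exists Y : submodClosed Q,
                finitely_generated (submod Y) /\ {subset P' <= Y}]),
      cp_le (cp_class P) (cp_class Q) <->
        (exists P' : submodClosed Q, pure P' /\ isomorphic P (submod P')) &
      cp_class P = cp_class Q <-> isomorphic P Q].
Proof.
move=> /stable_rank_one_ideal srR; have JI := in_rng_ideal R.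
have dualD (M : cpModule R) : dual_basis M.
  exact: projective_dual_basis (@cp_countable _ M) (@cp_projective _ M).
have fullD (M : cpModule R) : ideal_full (@in_rng R) M.
  exact: eq_PR_ideal_full (@cp_eq_PR _ M).
have [gP gPP] := cp_countable P; have [gQ gQP] := cp_countable Q.
split.
- split=> [PQ|[P' [P'pure PP' [Y [Yfg P'Y]]]]].
    have [n [v [w /(approximable_fg_embedding JI srR gPP (fullD Q))]]] :=
      prec_approximable (dualD P) (dualD Q) PQ.
    move=> [f [fs fv]]; exists (im_pred f : submodClosed Q); split.
    + exact: locally_split_pure.
    + exact/isomorphic_im/locally_split_inj.
    + exists (im_pred v : submodClosed Q); split; first exact/fg_im/fg_row.
      by move=> _ /asboolP[x <-]; have [c ->] := fv x; apply: mem_im.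
  exists Y; split=> // X Xfg.
  have [phi [psi [E phiP']]] := pure_embedding_factor (dualD Q) P'pure PP' Xfg.
  by exists phi, psi; split=> // x; exact: P'Y (phiP' x).
- rewrite cp_leP; split=> [PQ|[P' [P'pure PP']] X Xfg].
    have [f fs] := approximable_embedding JI srR gPP (dualD Q) (fullD Q)
      (precsim_approximable (dualD P) (dualD Q) PQ).
    exists (im_pred f : submodClosed Q); split; first exact: locally_split_pure.
    exact/isomorphic_im/locally_split_inj.
  have [phi [psi [E _]]] := pure_embedding_factor (dualD Q) P'pure PP' Xfg.
  by exists phi, psi.
rewrite cp_classP; split=> [[PQ QP]|]; last exact: isomorphic_precsim.
apply: (approximable_isomorphic JI srR gPP (dualD P) (fullD P) gQP) => //;
  exact: precsim_approximable.
Qed.
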